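(* Assume that $-2<\gamma<0$ and let $f_{\mathrm{in}}$ be an admissible initial datum with parameter $\varepsilon_0>0$. There is $C_0>0$, depending only on $\|f_{\mathrm{in}}\|_{L^1_2}$, such that for any $\varepsilon\in(0,\varepsilon_0]$, any $g\in\mathcal Y_\varepsilon(f_{\mathrm{in}})$ and any smooth and compactly supported function $\phi$ on $\mathbb R^3$, $$-\int_{\mathbb R^3}\phi^2\,c_\gamma[g]\,dv\le\delta\int_{\mathbb R^3}\Big|\nabla\big(\langle v\rangle^{\frac\gamma2}\phi(v)\big)\Big|^2dv+C_0\big(1+\delta^{\frac{\gamma}{2+\gamma}}\big)\int_{\mathbb R^3}\phi^2\langle v\rangle^\gamma\,dv,\qquad\forall\,\delta>0.$$
   Context: $\gamma$ is fixed and constants may depend on $\gamma$. $\langle v\rangle=(1+|v|^2)^{1/2}$; $\|g\|_{L^1_2}=\int|g|\langle v\rangle^2dv$; $c_\gamma[g](v)=-2(\gamma+3)\int_{\mathbb R^3}|v-v_*|^\gamma g(v_* )\,dv_*$. $H(g)=\int g\log g\,dv$; for $\varepsilon>0$, $0\le g\le\varepsilon^{-1}$, $\mathcal S_\varepsilon(g)=-\varepsilon^{-1}\int\big[\varepsilon g\log(\varepsilon g)+(1-\varepsilon g)\log(1-\varepsilon g)\big]dv$. Admissible datum: a nonnegative $f_{\mathrm{in}}\in L^1_2(\mathbb R^3)$ is an admissible initial datum with parameter $\varepsilon_0>0$ if $0<\|f_{\mathrm{in}}\|_{L^\infty}=\varepsilon_0^{-1}<\infty$, $\mathcal S_{\varepsilon_0}(f_{\mathrm{in}})>0$,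 $|H(f_{\mathrm{in}})|<\infty$, and $\int f_{\mathrm{in}}\,dv=1$, $\int f_{\mathrm{in}}v\,dv=0$, $\int f_{\mathrm{in}}|v|^2dv=3$. $\mathcal Y_\varepsilon(f_{\mathrm{in}})$ is the set of $g\in L^1_2(\mathbb R^3)$ with $0\le g\le\varepsilon^{-1}$, with the same integrals against $1,v,|v|^2$ as $f_{\mathrm{in}}$, and with $\mathcal S_\varepsilon(g)\ge\mathcal S_\varepsilon(f_{\mathrm{in}})$. *)

(* Defs.v *)
From HB Require Import structures.
From mathcomp Require Import all_boot all_order all_algebra.
From mathcomp Require Import all_classical all_reals all_analysis measurable_realfun.

Set Implicit Arguments.
Unset Strict Implicit.
Unset Printing Implicit Defensive.
Import Order.TTheory GRing.Theory Num.Theory.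
Import numFieldNormedType.Exports.

Local Open Scope classical_set_scope.
Local Open Scope ring_scope.

(* The norm that the library puts on R * R * R is the max norm; it is only used
   through its topology and directional derivatives.  Euclidean lengths are
   written enorm. *)
Notation vec3 R := (R * R * R)%type.

(* The library's sigma-finite instance on products only fires for finite
   factors, so sigma-finiteness is established by hand. *)
Lemma product_sigma_finite d1 d2 (T1 : measurableType d1)
    (T2 : measurableType d2) (R : realType)
    (m1 : {sigma_finite_measure set T1 -> \bar R})
    (m2 : {sigma_finite_measure set T2 -> \bar R}) :
  sigma_finite [set: T1 * T2] (m1 \x m2)%E.
Proof.
have /sigma_finiteP[F [TF ndF Foo]] := sigma_finiteT m1.
have /sigma_finiteP[G [TG ndG Goo]] := sigma_finiteT m2.
exists (fun n => F n `*` G n).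
  rewrite -setXTT TF TG predeqE => -[x y]; split.
    move=> [/= [n _ Fnx] [k _ Gky]]; exists (maxn n k) => //; split.
    - by move: x Fnx; exact/subsetPset/ndF/leq_maxl.
    - by move: y Gky; exact/subsetPset/ndG/leq_maxr.
  by move=> [n _ []/= ? ?]; split; exists n.
move=> k; have [mF Fk] := Foo k; have [mG Gk] := Goo k.
split; first exact: measurableX.
by rewrite product_measure1E// lte_mul_pinfty// ge0_fin_numE.
Qed.

Definition lebesgue2 (R : realType) :
    set (measurableTypeR R * measurableTypeR R) -> \bar R :=
  (@lebesgue_measure R \x @lebesgue_measure R)%E.

HB.instance Definition _ (R : realType) := Measure.on (@lebesgue2 R).
HB.instance Definition _ (R : realType) :=
  @Measure_isSigmaFinite.Build _ _ _ (@lebesgue2 R)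
    (product_sigma_finite (@lebesgue_measure R) (@lebesgue_measure R)).

Definition lebesgue3 (R : realType) :
    set (vec3 (measurableTypeR R)) -> \bar R :=
  (@lebesgue2 R \x @lebesgue_measure R)%E.

HB.instance Definition _ (R : realType) := Measure.on (@lebesgue3 R).
HB.instance Definition _ (R : realType) :=
  @Measure_isSigmaFinite.Build _ _ _ (@lebesgue3 R)
    (product_sigma_finite (@lebesgue2 R) (@lebesgue_measure R)).

Definition enorm (R : realType) (v : vec3 R) : R :=
  Num.sqrt (v.1.1 ^+ 2 + v.1.2 ^+ 2 + v.2 ^+ 2).

Definition bracket (R : realType) (v : vec3 R) : R :=
  Num.sqrt (1 + enorm v ^+ 2).

Definition unit3 (R : realType) (i : 'I_3) : vec3 R :=
  ((i == 0%N :> nat)%:R, (i == 1%N :> nat)%:R, (i == 2%N :> nat)%:R).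

Definition partial3 (R : realType) (i : 'I_3) (f : vec3 R -> R) : vec3 R -> R :=
  fun v => 'D_(unit3 R i) f v.

Definition grad3 (R : realType) (f : vec3 R -> R) (v : vec3 R) : vec3 R :=
  (partial3 (inord 0) f v, partial3 (inord 1) f v, partial3 (inord 2) f v).

Fixpoint Cn3 (R : realType) (n : nat) (f : vec3 R -> R) : Prop :=
  if n is k.+1 then
    continuous f /\
    forall i : 'I_3, (forall v, derivable f v (unit3 R i)) /\
                     Cn3 k (partial3 i f)
  else continuous f.

Definition smooth3 (R : realType) (f : vec3 R -> R) : Prop :=
  forall n, Cn3 n f.

Definition compactly_supported (R : realType) (f : vec3 R -> R) : Prop :=
  compact (closure [set v | f v != 0]).

Local Open Scope ereal_scope.

Definition normL12 (R : realType) (g : vec3 R -> R) : \bar R :=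
  \int[@lebesgue3 R]_v (`|g v| * bracket v ^+ 2)%:E.

(* Elements of L^1_2 are represented by Borel functions, so that pointwise
   conditions on them are read almost everywhere below. *)
Definition in_L12 (R : realType) (g : vec3 R -> R) : Prop :=
  measurable_fun [set: vec3 (measurableTypeR R)] g /\ normL12 g < +oo.

Definition entropyH (R : realType) (g : vec3 R -> R) : \bar R :=
  \int[@lebesgue3 R]_v (g v * ln (g v))%:E.

Definition entropyS (R : realType) (eps : R) (g : vec3 R -> R) : \bar R :=
  (- eps^-1)%:E *
  \int[@lebesgue3 R]_v (eps * g v * ln (eps * g v)
                        + (1 - eps * g v) * ln (1 - eps * g v))%:E.

Definition mass (R : realType) (g : vec3 R -> R) : \bar R :=
  \int[@lebesgue3 R]_v (g v)%:E.

Definition momentum (R : realType) (g : vec3 R -> R) :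
    \bar R * \bar R * \bar R :=
  (\int[@lebesgue3 R]_v (g v * v.1.1)%:E,
   \int[@lebesgue3 R]_v (g v * v.1.2)%:E,
   \int[@lebesgue3 R]_v (g v * v.2)%:E).

Definition energy (R : realType) (g : vec3 R -> R) : \bar R :=
  \int[@lebesgue3 R]_v (g v * enorm v ^+ 2)%:E.

(* The coefficient c_gamma[g]; for gamma < 0 the integrand is singular at w = v,
   a null set where powR takes the value 0. *)
Definition c_coef (R : realType) (gamma : R) (g : vec3 R -> R) (v : vec3 R) :
    \bar R :=
  (- 2 * (gamma + 3))%:E *
  \int[@lebesgue3 R]_w (enorm (v - w)%R `^ gamma * g w)%:E.

Definition admissible_datum (R : realType) (eps0 : R) (f : vec3 R -> R) : Prop :=
  [/\ in_L12 f,
      {ae @lebesgue3 R, forall v, (0 <= f v)%R},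
      (0 < 'N[@lebesgue3 R]_+oo[EFin \o f] < +oo /\
       'N[@lebesgue3 R]_+oo[EFin \o f] = (eps0^-1)%:E),
      (0 < entropyS eps0 f /\ `|entropyH f| < +oo) &
      [/\ mass f = 1, momentum f = (0, 0, 0) & energy f = 3%:E]].

Definition Yset (R : realType) (eps : R) (f : vec3 R -> R) :
    set (vec3 R -> R) :=
  [set g | [/\ in_L12 g,
               {ae @lebesgue3 R, forall v, (0 <= g v <= eps^-1)%R},
               mass g = mass f /\ momentum g = momentum f,
               energy g = energy f &
               entropyS eps f <= entropyS eps g]].

(* Main.v *)
Require Import Defs.
From mathcomp Require Import all_boot all_order all_algebra.
From mathcomp Require Import all_classical all_reals all_analysis measurable_realfun.
From mathcomp Require Import ring lra.

(** The coefficient [- c_coef gamma g] is [2 (gamma + 3)] times the potential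
[v |-> \int |v - w|^gamma g(w) dw], so the quantity to bound is a double
integral in [v] and [w].  The idea is to estimate it for each fixed [w], with a
constant that costs only a factor [<w>^2]; the integral of [g <w>^2] is the sum
of mass and energy, that is 4 for every competitor [g].

Fix [w] and put [psi = <v>^(gamma/2) phi], so that
[phi^2 |v - w|^gamma = psi^2 <v>^(-gamma) |v - w|^gamma].  Writing
[a = - gamma / 2], which lies in [(0, 1)], Peetre's inequality
[<v>^2 <= 2 <w>^2 <v - w>^2] gives
[<v>^(-gamma) |v - w|^gamma <= 2 <w>^2 (1 + |v - w|^(-2))^a], and Young's
inequality [s^a <= eta s + eta^(-a/(1-a))] trades the power [a] for a small
multiple of [|v - w|^(-2)] ([powR_young], [weighted_kernel_le]).  The exponent
[-a/(1-a)] is exactly [gamma/(2+gamma)].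

The term [psi^2 |v - w|^(-2)] is controlled by Hardy's inequality
[\int psi^2 |v - w|^(-2) <= 4 \int |grad psi|^2] ([hardy]).  It is derived
without the divergence theorem, from a one-dimensional integration by parts on
the lines parallel to each axis ([hardy_line]) arranged so that only nonnegative
integrands appear; Tonelli's theorem then sums the three directions
([hardy_coord], [hardy_regularised]).

Integrating against [g] ([potential_form_le]) and taking [eta] to be the minimum
of 1 and a multiple of [delta] ([eta_bounds]) yields the theorem.  The cap
[eta <= 1] is what prevents the constant from growing as [delta] tends to
infinity. *)

Import Order.TTheory GRing.Theory Num.Theory.
Import numFieldNormedType.Exports.

Local Open Scope classical_set_scope.
Local Open Scope ring_scope.

(** * Borel measurability of continuous functions *)

(** The product sigma-algebra is generated by boxes, while open sets are arbitrary
unions of boxes; an open set is nevertheless the union of the countably many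
boxes with rational center and radius [1 / n.+1] that it contains. *)
Lemma measurable_open3 {R : realType} (U : set (vec3 R)) :
  open U -> measurable (U : set (vec3 (measurableTypeR R))).
Proof.
move=> oU.
pose box (q : rat * rat * rat * nat) : set (vec3 R) :=
  (ball (ratr q.1.1.1 : R) q.2.+1%:R^-1 `*` ball (ratr q.1.1.2 : R) q.2.+1%:R^-1)
  `*` ball (ratr q.1.2 : R) q.2.+1%:R^-1.
have -> : U = \bigcup_(q in [set: rat * rat * rat * nat])
    (if asbool (box q `<=` U) then box q else set0).
  apply/seteqP; split => [[[x y] z] Ux|v [q _]]; last first.
    by case: asboolP => // + ?; apply.
  have /nbhs_ballP[e /= e0 eU] : nbhs (x, y, z) U by exact: open_nbhs_nbhs.
  have [n ne] : exists n, n.+1%:R^-1 < e / 2.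
    have := near_infty_natSinv_lt (PosNum (divr_gt0 e0 (ltr0n _ 2))).
    by move=> [N _ /(_ N (leqnn N)) /= ?]; exists N.
  have : 0 < n.+1%:R^-1 :> R by rewrite invr_gt0.
  move: ne; set r := n.+1%:R^-1 => re r0.
  have rat_near (t : R) : exists q : rat, `|ratr q - t| < r.
    have tt : t - r < t + r.
      by rewrite ltrD2l (lt_trans _ r0) // oppr_lt0.
    have [q] := rat_in_itvoo tt.
    rewrite in_itv /= => /andP[? ?]; exists q.
    by rewrite ltr_norml; apply/andP; split; lra.
  have [[a ha] [b hb]] := conj (rat_near x) (rat_near y).
  have [c hc] := rat_near z.
  exists (a, b, c, n) => //; case: asboolP => [_|]; first by split => //=.
  case=> -[[x' y'] z'] [[/= hx hy] hz]; apply: eU.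
  have close (q s t : R) : `|q - s| < r -> ball q r t -> ball s e t.
    rewrite /ball/= => qs qt.
    have -> : s - t = (q - t) - (q - s) by ring.
    by rewrite (le_lt_trans (ler_normB _ _)) //; lra.
  by split; [split|] => /=;
    [apply: close ha hx|apply: close hb hy|apply: close hc hz].
apply: countable_bigcupT_measurable => // q; case: asboolP => _ //.
by apply: measurableX; [apply: measurableX|]; exact: measurable_ball.
Qed.

Lemma continuous_measurable3 {R : realType} (f : vec3 R -> R) :
  continuous f -> measurable_fun [set: vec3 (measurableTypeR R)] f.
Proof.
move=> /continuousP cf; apply: (measurability _ (RGenOpens.measurableE R)).
move=> _ [_ [a [b ->] <-]]; rewrite setTI; apply: measurable_open3.
exact/cf/interval_open.
Qed.

(** * Coordinates and lines *)

Definition coord3 {R : realType} (i : 'I_3) (v : vec3 R) : R :=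
  if i == 0%N :> nat then v.1.1 else if i == 1%N :> nat then v.1.2 else v.2.

Lemma enorm_sqr {R : realType} (v : vec3 R) :
  enorm v ^+ 2 = v.1.1 ^+ 2 + v.1.2 ^+ 2 + v.2 ^+ 2.
Proof. by rewrite /enorm sqr_sqrtr // !addr_ge0 ?sqr_ge0. Qed.

Lemma sum_ord3 {R : realType} (F : 'I_3 -> R) :
  \sum_i F i = F (inord 0) + F (inord 1) + F (inord 2).
Proof.
rewrite !big_ord_recl big_ord0 addr0 addrA.
by congr (F _ + F _ + F _); apply/val_inj; rewrite /= inordK.
Qed.

Lemma enorm_sqr_sum {R : realType} (v : vec3 R) :
  enorm v ^+ 2 = \sum_i coord3 i v ^+ 2.
Proof. by rewrite sum_ord3 enorm_sqr /coord3 !inordK. Qed.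

Lemma enorm_grad_sqr {R : realType} (f : vec3 R -> R) (v : vec3 R) :
  enorm (grad3 f v) ^+ 2 = \sum_i partial3 i f v ^+ 2.
Proof. by rewrite sum_ord3 enorm_sqr. Qed.

Lemma coord3_line {R : realType} (i : 'I_3) (v : vec3 R) (t : R) :
  coord3 i (v + t *: unit3 R i) = coord3 i v + t.
Proof.
case: v => -[x y] z; case: i => -[|[|[|//]]] i3;
by rewrite /coord3 /= /GRing.scale/= mulr1.
Qed.

Lemma coord3_line_neq {R : realType} (i j : 'I_3) (v : vec3 R) (t : R) :
  j != i -> coord3 j (v + t *: unit3 R i) = coord3 j v.
Proof.
case: v => -[x y] z; case: i => -[|[|[|//]]] i3; case: j => -[|[|[|//]]] j3 //= _;
by rewrite /coord3 /= /GRing.scale/= mulr0 addr0.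
Qed.

Lemma continuous_coord3 {R : realType} (i : 'I_3) : continuous (@coord3 R i).
Proof.
rewrite /coord3; case: (i == 0%N :> nat); last case: (i == 1%N :> nat); move=> v.
- by apply: (@continuous_comp _ _ _ fst fst); exact: cvg_fst.
- by apply: (@continuous_comp _ _ _ fst snd); [exact: cvg_fst|exact: cvg_snd].
- exact: cvg_snd.
Qed.

Lemma coord3B {R : realType} (i : 'I_3) (v w : vec3 R) :
  coord3 i (v - w) = coord3 i v - coord3 i w.
Proof. by rewrite /coord3; case: ifP => _ //; case: ifP. Qed.

Lemma continuous_coord3B {R : realType} (i : 'I_3) (w : vec3 R) :
  continuous (fun v : vec3 R => coord3 i (v - w)).
Proof.
have -> : (fun v : vec3 R => coord3 i (v - w)) =
    fun v : vec3 R => coord3 i v - coord3 i w.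
  by apply/funext => v; exact: coord3B.
by move=> v; apply: cvgB; [exact: continuous_coord3|exact: cvg_cst].
Qed.

Lemma continuous_enorm_sqr {R : realType} (w : vec3 R) :
  continuous (fun v : vec3 R => enorm (v - w) ^+ 2).
Proof.
have -> : (fun v : vec3 R => enorm (v - w) ^+ 2) =
    fun v : vec3 R => coord3 (inord 0) (v - w) ^+ 2
      + coord3 (inord 1) (v - w) ^+ 2 + coord3 (inord 2) (v - w) ^+ 2.
  by apply/funext => v; rewrite enorm_sqr_sum sum_ord3.
by move=> v; apply: cvgD; first apply: cvgD; apply: cvgM; exact: continuous_coord3B.
Qed.

Lemma enorm_sqr_line {R : realType} (i : 'I_3) (v : vec3 R) (t : R) :
  enorm (v + t *: unit3 R i) ^+ 2 = enorm v ^+ 2 + 2 * coord3 i v * t + t ^+ 2.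
Proof.
rewrite !enorm_sqr_sum (bigD1 i)//= [in RHS](bigD1 i)//= coord3_line.
under eq_bigr => j ji do rewrite coord3_line_neq//.
ring.
Qed.

(** The difference quotients of [f] in the direction [e] and of its restriction to
the line are the same functions of the increment. *)
Lemma is_derive_lineP {R : realType} (f : vec3 R -> R) (v e : vec3 R) (t df : R) :
  is_derive t (1 : R) (fun r : R => f (v + r *: e)) df <->
  is_derive (v + t *: e) e f df.
Proof.
have E : (fun h : R => h^-1 *: (((fun r : R => f (v + r *: e)) \o shift t) (h *: 1)
      - f (v + t *: e))) =
    (fun h => h^-1 *: ((f \o shift (v + t *: e)) (h *: e) - f (v + t *: e))).
  apply/funext => h /=; have -> : h *: (1 : R) = h by exact: mulr1.
  by congr (_ *: (f _ - _)); rewrite scalerDl addrCA.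
by split=> -[fd fE]; (apply: DeriveDef; [move: fd|move: fE]);
  rewrite /derivable /derive E.
Qed.

Lemma measurable_enorm_sqr {R : realType} :
  measurable_fun [set: vec3 (measurableTypeR R)] (fun v => enorm v ^+ 2).
Proof.
rewrite (_ : (fun v => _) = fun v : vec3 R => enorm (v - 0) ^+ 2).
  by apply: continuous_measurable3; exact: continuous_enorm_sqr.
by apply/funext => v; rewrite subr0.
Qed.

Lemma measurable_inv_enorm_sqr {R : realType} (w : vec3 R) :
  measurable_fun [set: vec3 (measurableTypeR R)]
    (fun v => (enorm (v - w)%R ^+ 2)^-1).
Proof.
rewrite (_ : (fun v => _) = (@powR R ^~ (- 1)) \o (fun v => enorm (v - w) ^+ 2)).
  apply: measurableT_comp; first exact: measurable_powR.
  by apply: continuous_measurable3; exact: continuous_enorm_sqr.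
by apply/funext => v /=; rewrite powR_inv1 // sqr_ge0.
Qed.

(** * Hardy's inequality *)

(** Integrating the derivative of [psi^2 y], where [y = (x - c) / ((x - c)^2 + s)],
gives zero, and [y' = 1 / ((x - c)^2 + s) - 2 y^2].  The cross term is absorbed by
[- 2 psi psi' y <= psi^2 y^2 / 2 + 2 psi'^2].  The sign-changing [y'] is split
between the two sides, so that both integrands are nonnegative and the inequality
can be integrated over the remaining coordinates with Tonelli's theorem. *)
Lemma hardy_line {R : realType} (psi : R -> R) (A c s : R) :
    0 < s -> (forall x, derivable psi x 1) -> continuous (psi^`())%classic ->
    (forall x, A < `|x| -> psi x = 0) ->
  (\int[@lebesgue_measure R]_x (psi x ^+ 2 / ((x - c) ^+ 2 + s))%:E <=
   \int[@lebesgue_measure R]_x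
     (5 / 2 * (psi x ^+ 2 * (x - c) ^+ 2 / ((x - c) ^+ 2 + s) ^+ 2)
      + 2 * (psi^`()%classic x) ^+ 2)%:E)%E.
Proof.
move=> s0 dpsi cdpsi supp.
set dp := (psi^`())%classic in cdpsi *.
pose q x := (x - c) ^+ 2 + s.
have q0 x : 0 < q x by rewrite ltr_wpDl// sqr_ge0.
have qN0 x : q x != 0 by rewrite gt_eqF.
have cpsi : continuous psi.
  by move=> x; apply/differentiable_continuous/derivable1_diffP.
have cq : continuous q.
  move=> x; apply: cvgD; last exact: cvg_cst.
  by apply: cvgM; (apply: cvgB; [exact: cvg_id|exact: cvg_cst]).
pose G x := psi x ^+ 2 * ((x - c) / q x).
pose u x := psi x ^+ 2 / q x.
pose dG x := 2 * psi x * dp x * ((x - c) / q x) + psi x ^+ 2 / q x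
  - 2 * (psi x ^+ 2 * (x - c) ^+ 2 / q x ^+ 2).
pose w x := 5 / 2 * (psi x ^+ 2 * (x - c) ^+ 2 / q x ^+ 2) + 2 * dp x ^+ 2.
have Gd (x : R) : is_derive x (1 : R) G (dG x).
  have pd : is_derive x 1 psi (dp x).
    by rewrite /dp derive1E; apply: DeriveDef.
  have qd : is_derive x 1 q (2 * (x - c)).
    rewrite /q; apply: is_derive_eq.
    by rewrite /GRing.scale/=; ring.
  have vd := is_deriveV (qN0 x) qd.
  rewrite /G; apply: is_derive_eq.
  by rewrite /dG /GRing.scale/=; field; exact: qN0.
have c_lin : continuous (fun x : R => x - c).
  by move=> x; apply: cvgB; [exact: cvg_id|exact: cvg_cst].
have cu : continuous u.
  move=> x; apply: cvgM; first by apply: cvgM; exact: cpsi.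
  by apply: cvgV => //; exact: cq.
have csq : continuous (fun x => psi x ^+ 2 * (x - c) ^+ 2 / q x ^+ 2).
  move=> x; apply: cvgM; first apply: cvgM.
  - by apply: cvgM; exact: cpsi.
  - by apply: cvgM; exact: c_lin.
  - by apply: cvgV; [rewrite expf_neq0|apply: cvgM; exact: cq].
have cdG : continuous dG.
  move=> x; apply: cvgB; last by apply: cvgM; [exact: cvg_cst|exact: csq].
  apply: cvgD; last exact: cu.
  apply: cvgM; first apply: cvgM.
  - by apply: cvgM; [exact: cvg_cst|exact: cpsi].
  - exact: cdpsi.
  - by apply: cvgM; [exact: c_lin|apply: cvgV; [exact: qN0|exact: cq]].
have cw : continuous w.
  move=> x; apply: cvgD; apply: cvgM; [exact: cvg_cst|exact: csq|exact: cvg_cst|].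
  by apply: cvgM; exact: cdpsi.
pose b : R := `|A| + 1.
have b0 : 0 < b by rewrite ltr_wpDl.
have supp_b x : b <= `|x| -> psi x = 0.
  move=> bx; apply: supp; rewrite (le_lt_trans (ler_norm A))//.
  by rewrite (lt_le_trans _ bx)// ltrDl.
have mI : measurable (`[(- b), b]%classic : set (measurableTypeR R)) by [].
have intb (f : R -> R) : continuous f ->
    (@lebesgue_measure R).-integrable `[(- b), b] (EFin \o f).
  move=> cf; apply: continuous_compact_integrable; first exact: segment_compact.
  by apply: continuous_subspaceT.
have intG : (\int[@lebesgue_measure R]_(x in `[(- b)%R, b]) (dG x)%:E = 0)%E.
  have bb : - b < b by lra.
  rewrite (continuous_FTC2 bb (F := G)); first last.
  - by move=> x _; rewrite derive1E; have [_ ->] := Gd x.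
  - have cG : continuous G.
      move=> x; apply/differentiable_continuous/derivable1_diffP.
      by have [] := Gd x.
    split; first by move=> x _; have [] := Gd x.
    + by apply: cvg_at_right_filter; exact: cG.
    + by apply: cvg_at_left_filter; exact: cG.
  - by apply: continuous_subspaceT.
  - by rewrite /G (supp_b b) ?(supp_b (- b)) ?normrN ?(gtr0_norm b0)//
      expr0n/= !mul0r subee.
have uE : (\int[@lebesgue_measure R]_x (u x)%:E =
    \int[@lebesgue_measure R]_(x in `[(- b)%R, b]) (u x)%:E)%E.
  rewrite [RHS]integral_mkcond; apply: eq_integral => x _.
  rewrite patchE; case: ifPn => // /negP xb.
  rewrite /u supp_b ?expr0n/= ?mul0r// leNgt; apply/negP => xb'; apply: xb.
  by rewrite inE/= in_itv/= -ler_norml ltW.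
change (\int[@lebesgue_measure R]_x (u x)%:E
  <= \int[@lebesgue_measure R]_x (w x)%:E)%E.
rewrite uE.
apply: (@le_trans _ _ (\int[@lebesgue_measure R]_(x in `[(- b)%R, b]) (w x)%:E)%E).
  rewrite -[leLHS]sube0 -[X in (_ - X)%E]intG.
  rewrite -integralB_EFin//; [|exact: intb|exact: intb].
  apply: le_integral => //.
  - rewrite (_ : (fun x => _) = EFin \o (u \- dG)) //.
    by apply: intb => x; apply: cvgB; [exact: cu|exact: cdG].
  - exact: intb.
  - move=> x _; rewrite lee_fin /u /dG /w -subr_ge0.
    set y := _ - _.
    (* Completing the square is the weighted Young inequality of the cross term. *)
    have -> : y = 1 / 2 * (psi x * ((x - c) / q x) + 2 * dp x) ^+ 2.
      by rewrite /y; field; exact: qN0.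
    by rewrite mulr_ge0// sqr_ge0.
apply: ge0_subset_integral => //.
- by apply/measurable_EFinP; exact: continuous_measurable_fun.
- move=> x _; rewrite lee_fin; apply: addr_ge0; last by rewrite mulr_ge0 ?sqr_ge0.
  apply: mulr_ge0; first by rewrite divr_ge0.
  by apply: divr_ge0; [apply: mulr_ge0|]; rewrite sqr_ge0.
Qed.

Lemma le_integral_prod1 {R : realType} {d1 d2} {T1 : measurableType d1}
    {T2 : measurableType d2}
    (m1 : {sigma_finite_measure set T1 -> \bar R})
    (m2 : {sigma_finite_measure set T2 -> \bar R}) (F G : T1 * T2 -> \bar R) :
  measurable_fun setT F -> measurable_fun setT G ->
  (forall p, (0 <= F p)%E) -> (forall p, (0 <= G p)%E) ->
  (forall x, (\int[m2]_y F (x, y) <= \int[m2]_y G (x, y))%E) ->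
  (\int[m1 \x m2]_p F p <= \int[m1 \x m2]_p G p)%E.
Proof.
move=> mF mG F0 G0 FG; rewrite !fubini_tonelli1//.
apply: ge0_le_integral => //.
- by move=> x _; exact: integral_ge0.
- exact: measurable_fun_fubini_tonelli_F.
- exact: measurable_fun_fubini_tonelli_F.
- by move=> ? _; exact: FG.
Qed.

Lemma le_integral_prod2 {R : realType} {d1 d2} {T1 : measurableType d1}
    {T2 : measurableType d2}
    (m1 : {sigma_finite_measure set T1 -> \bar R})
    (m2 : {sigma_finite_measure set T2 -> \bar R}) (F G : T1 * T2 -> \bar R) :
  measurable_fun setT F -> measurable_fun setT G ->
  (forall p, (0 <= F p)%E) -> (forall p, (0 <= G p)%E) ->
  (forall y, (\int[m1]_x F (x, y) <= \int[m1]_x G (x, y))%E) ->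
  (\int[m1 \x m2]_p F p <= \int[m1 \x m2]_p G p)%E.
Proof.
move=> mF mG F0 G0 FG; rewrite !fubini_tonelli2//.
apply: ge0_le_integral => //.
- by move=> x _; exact: integral_ge0.
- exact: measurable_fun_fubini_tonelli_G.
- exact: measurable_fun_fubini_tonelli_G.
- by move=> ? _; exact: FG.
Qed.

Lemma le_integral_lines {R : realType} (i : 'I_3)
    (F G : vec3 (measurableTypeR R) -> \bar R) :
  measurable_fun setT F -> measurable_fun setT G ->
  (forall v, (0 <= F v)%E) -> (forall v, (0 <= G v)%E) ->
  (forall v : vec3 R,
    (\int[@lebesgue_measure R]_t F (v + (t : R) *: unit3 R i)%R
     <= \int[@lebesgue_measure R]_t G (v + (t : R) *: unit3 R i)%R)%E) ->
  (\int[@lebesgue3 R]_v F v <= \int[@lebesgue3 R]_v G v)%E.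
Proof.
move=> mF mG F0 G0.
have unitE (j : 'I_3) (H : vec3 R -> \bar R) x y z t :
    H ((x, y, z) + t *: unit3 R j) =
    H (x + t * (j == 0%N :> nat)%:R, y + t * (j == 1%N :> nat)%:R,
       z + t * (j == 2%N :> nat)%:R) by [].
case: i => -[|[|[|//]]] /= i3 FG.
- apply: (le_integral_prod2 (@lebesgue2 R)) => // z.
  apply: (le_integral_prod2 (@lebesgue_measure R)) => //;
    [exact: measurable_fun_pair1|exact: measurable_fun_pair1|move=> y].
  have := FG (0, y, z).
  under eq_integral do rewrite unitE /= add0r mulr1 !mulr0 !addr0.
  by under [leRHS]eq_integral do rewrite unitE /= add0r mulr1 !mulr0 !addr0.
- apply: (le_integral_prod2 (@lebesgue2 R)) => // z.
  apply: (le_integral_prod1 (@lebesgue_measure R)) => //;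
    [exact: measurable_fun_pair1|exact: measurable_fun_pair1|move=> x].
  have := FG (x, 0, z).
  under eq_integral do rewrite unitE /= add0r mulr1 !mulr0 !addr0.
  by under [leRHS]eq_integral do rewrite unitE /= add0r mulr1 !mulr0 !addr0.
- apply: (le_integral_prod1 (@lebesgue2 R)) => // -[x y].
  have := FG (x, y, 0).
  under eq_integral do rewrite unitE /= add0r mulr1 !mulr0 !addr0.
  by under [leRHS]eq_integral do rewrite unitE /= add0r mulr1 !mulr0 !addr0.
Qed.

Lemma continuous_hardy_lhs {R : realType} (psi : vec3 R -> R) (w : vec3 R) (s : R) :
  continuous psi -> 0 < s ->
  continuous (fun v : vec3 R => psi v ^+ 2 / (enorm (v - w) ^+ 2 + s)).
Proof.
move=> cpsi s0 v; apply: cvgM; first by apply: cvgM; exact: cpsi.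
apply: cvgV; first by rewrite gt_eqF// ltr_wpDl// sqr_ge0.
by apply: cvgD; [exact: continuous_enorm_sqr|exact: cvg_cst].
Qed.

Lemma continuous_hardy_rhs {R : realType} (i : 'I_3) (psi : vec3 R -> R)
    (w : vec3 R) (s : R) :
  Cn3 1 psi -> 0 < s ->
  continuous (fun v : vec3 R =>
    5 / 2 * (psi v ^+ 2 * coord3 i (v - w) ^+ 2 / (enorm (v - w) ^+ 2 + s) ^+ 2)
    + 2 * partial3 i psi v ^+ 2).
Proof.
move=> [cpsi /(_ i)[_ cdpsi]] s0 v.
have q0 : enorm (v - w) ^+ 2 + s != 0 by rewrite gt_eqF// ltr_wpDl// sqr_ge0.
apply: cvgD; (apply: cvgM; first exact: cvg_cst); last first.
  by apply: cvgM; exact: cdpsi.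
apply: cvgM; first apply: cvgM.
- by apply: cvgM; exact: cpsi.
- by apply: cvgM; exact: continuous_coord3B.
apply: cvgV; first by rewrite expf_neq0.
by apply: cvgM; (apply: cvgD; [exact: continuous_enorm_sqr|exact: cvg_cst]).
Qed.

Lemma hardy_rhs_ge0 {R : realType} (a b c d : R) :
  0 <= 5 / 2 * (a ^+ 2 * b ^+ 2 / c ^+ 2) + 2 * d ^+ 2.
Proof.
apply: addr_ge0; last by rewrite mulr_ge0 ?sqr_ge0.
apply: mulr_ge0; first by rewrite divr_ge0.
by apply: divr_ge0; [apply: mulr_ge0|]; rewrite sqr_ge0.
Qed.

(** One third of Hardy's inequality.  The other squared coordinates are constant on
a line parallel to the axis [i] and only increase the regularisation parameter. *)
Lemma hardy_coord {R : realType} (i : 'I_3) (psi : vec3 R -> R) (A : R)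
    (w : vec3 R) (s : R) :
  Cn3 1 psi -> (forall v j, A < `|coord3 j v| -> psi v = 0) -> 0 < s ->
  (\int[@lebesgue3 R]_v (psi v ^+ 2 / (enorm (v - w) ^+ 2 + s))%:E <=
   \int[@lebesgue3 R]_v
     (5 / 2 * (psi v ^+ 2 * (coord3 i (v - w)) ^+ 2
               / (enorm (v - w) ^+ 2 + s) ^+ 2)
      + 2 * partial3 i psi v ^+ 2)%:E)%E.
Proof.
move=> psi1 supp s0; have [cpsi /(_ i)[dpsi cdpsi]] := psi1.
apply: (le_integral_lines i).
- by apply/measurable_EFinP; apply: continuous_measurable3;
    exact: continuous_hardy_lhs.
- by apply/measurable_EFinP; apply: continuous_measurable3;
    exact: continuous_hardy_rhs.
- by move=> v; rewrite lee_fin divr_ge0 ?addr_ge0 ?sqr_ge0// ltW.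
- by move=> v; rewrite lee_fin; exact: hardy_rhs_ge0.
move=> v.
pose f (t : R) := psi (v + t *: unit3 R i).
(* On the line, [|v - w|^2 + s] is [(t - c)^2 + r]. *)
pose r := \sum_(j | j != i) coord3 j (v - w) ^+ 2 + s.
have r0 : 0 < r by rewrite ltr_wpDl// sumr_ge0// => j _; rewrite sqr_ge0.
pose c := - coord3 i (v - w).
have lineE (t : R) : v + t *: unit3 R i - w = (v - w) + t *: unit3 R i.
  by rewrite addrAC.
have lineEi (t : R) : coord3 i (v + t *: unit3 R i - w) = t - c.
  by rewrite lineE coord3_line opprK addrC.
have lineEq (t : R) : enorm (v + t *: unit3 R i - w) ^+ 2 + s = (t - c) ^+ 2 + r.
  rewrite enorm_sqr_sum (bigD1 i)//= lineEi -addrA; congr (_ + (_ + _)).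
  by apply: eq_bigr => j ji; rewrite lineE coord3_line_neq.
have df (t : R) : is_derive t (1 : R) f (partial3 i psi (v + t *: unit3 R i)).
  by apply/is_derive_lineP; apply: DeriveDef => //; exact: dpsi.
have f'E t : (f^`())%classic t = partial3 i psi (v + t *: unit3 R i).
  by rewrite derive1E; have [_ ->] := df t.
have cline : continuous (fun t : R => v + t *: unit3 R i).
  by move=> t; apply: cvgD; [exact: cvg_cst|apply: cvgZr_tmp; exact: cvg_id].
have f1 t : derivable f t 1 by have [] := df t.
have f2 : continuous (f^`())%classic.
  have -> : (f^`())%classic = partial3 i psi \o (fun t : R => v + t *: unit3 R i).
    by apply/funext.
  by move=> t; apply: continuous_comp; [exact: cline|exact: cdpsi].
have f3 t : A + `|coord3 i v| < `|t| -> f t = 0.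
  move=> At; apply: (supp _ i); rewrite coord3_line.
  have := ler_normB (coord3 i v + t) (coord3 i v).
  by rewrite addrAC subrr add0r; lra.
have := hardy_line f _ c r r0 f1 f2 f3.
have -> : (fun t => (psi (v + (t : R) *: unit3 R i)%R ^+ 2
      / (enorm (v + (t : R) *: unit3 R i - w)%R ^+ 2 + s))%:E) =
    fun t => (f t ^+ 2 / ((t - c) ^+ 2 + r))%:E.
  by apply/funext => t; rewrite lineEq.
have wE (t : R) : 5 / 2 * (psi (v + t *: unit3 R i) ^+ 2
      * coord3 i (v + t *: unit3 R i - w) ^+ 2
      / (enorm (v + t *: unit3 R i - w) ^+ 2 + s) ^+ 2)
      + 2 * partial3 i psi (v + t *: unit3 R i) ^+ 2 =
    5 / 2 * (f t ^+ 2 * (t - c) ^+ 2 / ((t - c) ^+ 2 + r) ^+ 2)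
      + 2 * (f^`())%classic t ^+ 2.
  by rewrite f'E lineEq lineEi.
move=> H; apply: (le_trans H); rewrite le_eqVlt; apply/orP; left; apply/eqP.
by apply: eq_integral => t _; exact: congr1 (esym (wE t)).
Qed.

(** Adding the three directional inequalities, the squared coordinates add up to
[|v - w|^2 <= |v - w|^2 + s], so that [3 I <= 5/2 I + 2 D], where [I] and [D] are
the integrals on the two sides.  The parameter [s] and the integrability of
[psi^2] make [I] finite, so that [5/2 I] can be subtracted. *)
Lemma hardy_regularised {R : realType} (psi : vec3 R -> R) (A : R)
    (w : vec3 R) (s : R) :
  Cn3 1 psi -> (forall v j, A < `|coord3 j v| -> psi v = 0) -> 0 < s ->
  (\int[@lebesgue3 R]_v (psi v ^+ 2)%:E < +oo)%E ->
  (\int[@lebesgue3 R]_v (psi v ^+ 2 / (enorm (v - w) ^+ 2 + s))%:E <=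
   4%:E * \int[@lebesgue3 R]_v (enorm (grad3 psi v) ^+ 2)%:E)%E.
Proof.
move=> psi1 supp s0 fin; have [cpsi dpsi] := psi1.
pose u (v : vec3 R) := psi v ^+ 2 / (enorm (v - w) ^+ 2 + s).
pose m i (v : vec3 R) :=
  5 / 2 * (psi v ^+ 2 * coord3 i (v - w) ^+ 2 / (enorm (v - w) ^+ 2 + s) ^+ 2)
  + 2 * partial3 i psi v ^+ 2.
have q0 v : 0 < enorm (v - w) ^+ 2 + s by rewrite ltr_wpDl// sqr_ge0.
have cu : continuous u by exact: continuous_hardy_lhs.
have u0 v : 0 <= u v by rewrite /u divr_ge0 ?sqr_ge0// ltW.
have cm i : continuous (m i) by exact: continuous_hardy_rhs.
have m0 i v : 0 <= m i v by exact: hardy_rhs_ge0.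
have mE (f : vec3 R -> R) : continuous f ->
    measurable_fun [set: vec3 (measurableTypeR R)] (EFin \o f).
  by move=> cf; apply/measurable_EFinP; exact: continuous_measurable3.
have mpsi2 : measurable_fun [set: vec3 (measurableTypeR R)]
    (fun v => (psi v ^+ 2)%:E).
  by apply: mE => v; apply: cvgM; exact: cpsi.
pose I := (\int[@lebesgue3 R]_v (u v)%:E)%E.
pose D := (\int[@lebesgue3 R]_v (enorm (grad3 psi v) ^+ 2)%:E)%E.
have D0 : (0 <= D)%E by apply: integral_ge0 => v _; rewrite lee_fin sqr_ge0.
have I0 : (0 <= I)%E by apply: integral_ge0 => v _; rewrite lee_fin.
have Ioo : (I < +oo)%E.
  apply: (@le_lt_trans _ _ (\int[@lebesgue3 R]_v (s^-1%:E * (psi v ^+ 2)%:E))%E).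
    apply: ge0_le_integral => //.
    - by move=> v _; rewrite lee_fin.
    - exact: mE.
    - by apply: measurable_funeM.
    - move=> v _; rewrite -EFinM lee_fin /u mulrC ler_wpM2r ?sqr_ge0//.
      by rewrite lef_pV2 ?posrE// lerDr sqr_ge0.
  rewrite ge0_integralZl_EFin//.
  - by rewrite lte_mul_pinfty// lee_fin invr_ge0 ltW.
  - by move=> v _; rewrite lee_fin sqr_ge0.
  - by rewrite invr_ge0 ltW.
have Ifin : I \is a fin_num by rewrite ge0_fin_numE.
have cD : continuous (fun v => enorm (grad3 psi v) ^+ 2).
  rewrite (_ : (fun v => _) = fun v => partial3 (inord 0) psi v ^+ 2
      + partial3 (inord 1) psi v ^+ 2 + partial3 (inord 2) psi v ^+ 2); last first.
    by apply/funext => v; rewrite enorm_grad_sqr sum_ord3.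
  by move=> v; apply: cvgD; first apply: cvgD; apply: cvgM; exact: (dpsi _).2.
have sum3 (J : 'I_3 -> \bar R) : (forall i, I <= J i)%E ->
    (I + (I + I) <= \sum_(i < 3) J i)%E.
  move=> IJ; rewrite !big_ord_recl big_ord0 adde0.
  by apply: leeD => //; exact: leeD.
have sumI : (I + (I + I) <= (5 / 2)%:E * I + 2%:E * D)%E.
  have step i : (I <= \int[@lebesgue3 R]_v (m i v)%:E)%E.
    exact: hardy_coord psi1 supp s0.
  have mm i : measurable_fun [set: vec3 (measurableTypeR R)]
      (fun v => (m i v)%:E) by exact: mE.
  apply: (@le_trans _ _ (\sum_(i < 3) \int[@lebesgue3 R]_v (m i v)%:E)%E).
    exact: sum3.
  rewrite -ge0_integral_sum//; last by move=> i v _; rewrite lee_fin.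
  rewrite -!ge0_integralZl_EFin//; last first.
  - exact: mE.
  - by move=> v _; rewrite lee_fin.
  - exact: mE.
  - by move=> v _; rewrite lee_fin sqr_ge0.
  rewrite -ge0_integralD//.
  - apply: ge0_le_integral => //.
    + by move=> v _; apply: sume_ge0 => i _; rewrite lee_fin.
    + exact: emeasurable_sum.
    + by apply: emeasurable_funD; apply: measurable_funeM; exact: mE.
    move=> v _; rewrite sumEFin -!EFinM -EFinD lee_fin big_split /=.
    rewrite -!mulr_sumr -enorm_grad_sqr.
    rewrite (eq_bigr (fun i : 'I_3 => coord3 i (v - w) ^+ 2
      * (psi v ^+ 2 / (enorm (v - w) ^+ 2 + s) ^+ 2))); last first.
      by move=> i _; rewrite mulrAC mulrC mulrA.
    rewrite -mulr_suml -enorm_sqr_sum lerD2r ler_wpM2l ?divr_ge0//.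
    set e := enorm _ ^+ 2; rewrite /u -/e -subr_ge0.
    have es : e + s != 0 by rewrite gt_eqF ?(q0 v).
    set d := _ - _.
    have -> : d = psi v ^+ 2 * s / (e + s) ^+ 2 by rewrite /d; field.
    apply: divr_ge0; last exact: sqr_ge0.
    by apply: mulr_ge0; [exact: sqr_ge0|exact: ltW].
  - by move=> v _; rewrite mule_ge0 ?lee_fin.
  - by apply: measurable_funeM; exact: mE.
  - by move=> v _; rewrite mule_ge0 ?lee_fin ?sqr_ge0.
  - by apply: measurable_funeM; exact: mE.
have [Doo|Doo] := eqVneq D +oo%E.
  by rewrite [leRHS](_ : _ = +oo%E) ?leey// -/D Doo gt0_muley.
have Dfin : D \is a fin_num by rewrite ge0_fin_numE// ltey.
change (I <= 4%:E * D)%E.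
move: sumI; rewrite -(fineK Ifin) -(fineK Dfin) -!EFinM -!EFinD !lee_fin.
by lra.
Qed.

(** The limit [s -> 0] of [hardy_regularised].  At [v = w] the quotient is 0 by the
convention [0^-1 = 0], which is not the limit of the regularised quotients. *)
Lemma hardy {R : realType} (psi : vec3 R -> R) (A : R) (w : vec3 R) :
  Cn3 1 psi -> (forall v j, A < `|coord3 j v| -> psi v = 0) ->
  (\int[@lebesgue3 R]_v (psi v ^+ 2)%:E < +oo)%E ->
  (\int[@lebesgue3 R]_v (psi v ^+ 2 / enorm (v - w) ^+ 2)%:E <=
   4%:E * \int[@lebesgue3 R]_v (enorm (grad3 psi v) ^+ 2)%:E)%E.
Proof.
move=> psi1 supp fin; have [cpsi dpsi] := psi1.
pose e (v : vec3 R) := enorm (v - w) ^+ 2.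
(* The factor [e / (e + 1 / n.+1)] makes the approximations vanish at [v = w], so
   that they converge everywhere, not only off that point. *)
pose h n (v : vec3 R) := psi v ^+ 2 / e v * (e v / (e v + n.+1%:R^-1)).
have e0 v : 0 <= e v by exact: sqr_ge0.
have ehn n v : 0 < e v + n.+1%:R^-1 by rewrite ltr_wpDl.
have h0 n v : 0 <= h n v.
  by rewrite /h mulr_ge0 ?divr_ge0 ?sqr_ge0// ltW.
have mpsi2 : measurable_fun [set: vec3 (measurableTypeR R)] (fun v => psi v ^+ 2).
  by apply: continuous_measurable3 => v; apply: cvgM; exact: cpsi.
have cen n : continuous (fun v => e v + n.+1%:R^-1).
  by move=> v; apply: cvgD; [exact: continuous_enorm_sqr|exact: cvg_cst].
have mh n : measurable_fun [set: vec3 (measurableTypeR R)] (h n).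
  apply: measurable_funM.
    by apply: measurable_funM => //; exact: measurable_inv_enorm_sqr.
  apply: continuous_measurable3 => v; apply: cvgM; first exact: continuous_enorm_sqr.
  by apply: cvgV; [rewrite gt_eqF|exact: cen].
have ndh v m n : (m <= n)%N -> h m v <= h n v.
  move=> mn; rewrite /h ler_wpM2l ?divr_ge0 ?sqr_ge0//.
  by rewrite ler_wpM2l// lef_pV2 ?posrE// lerD2l lef_pV2 ?posrE// ler_nat.
have cvh v : (h n v)%:E @[n --> \oo] --> (psi v ^+ 2 / e v)%:E.
  suff H : h n v @[n --> \oo] --> psi v ^+ 2 / e v.
    by apply: cvg_EFin; [near=> n|exact: H].
  rewrite /h; have [->|ev] := eqVneq (e v) 0.
    by rewrite invr0 mulr0; under eq_fun do rewrite mul0r; exact: cvg_cst.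
  rewrite -[X in _ --> X]mulr1; apply: cvgM; first exact: cvg_cst.
  rewrite -[X in _ --> X](mulfV ev); apply: cvgM; first exact: cvg_cst.
  apply: cvgV => //; rewrite -[X in _ --> X]addr0.
  by apply: cvgD; [exact: cvg_cst|exact: cvg_harmonic].
have -> : (fun v => (psi v ^+ 2 / enorm (v - w)%R ^+ 2)%:E) =
    fun v => limn (fun n => EFin (h n v)).
  by apply/funext => v; apply/esym/cvg_lim; [|exact: cvh].
rewrite monotone_convergence//; last 3 first.
- by move=> n; apply/measurable_EFinP.
- by move=> n v _; rewrite lee_fin.
- by move=> v _ m n mn; rewrite lee_fin ndh.
apply: lime_le.
  apply: ereal_nondecreasing_is_cvgn => m n mn; apply: ge0_le_integral => //.
  - by move=> v _; rewrite lee_fin.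
  - exact/measurable_EFinP.
  - exact/measurable_EFinP.
  - by move=> v _; rewrite lee_fin ndh.
apply: nearW => n.
apply: le_trans (@hardy_regularised _ psi A w n.+1%:R^-1 psi1 supp _ fin); last first.
  by rewrite invr_gt0.
apply: ge0_le_integral => //.
- by move=> v _; rewrite lee_fin.
- exact/measurable_EFinP.
- apply/measurable_EFinP; apply: continuous_measurable3 => v; apply: cvgM.
    by apply: cvgM; exact: cpsi.
  by apply: cvgV; [rewrite gt_eqF ?(ehn n v)|exact: cen].
- move=> v _; rewrite lee_fin /h -/(e v).
  rewrite -mulrA ler_wpM2l ?sqr_ge0// mulrA.
  have [->|ev] := eqVneq (e v) 0; first by rewrite invr0 !mul0r invr_ge0 add0r.
  by rewrite mulVf ?mul1r.
Unshelve. all: by end_near.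
Qed.

(** * The singular kernel against the weight *)

(** Both bounds meet at the threshold [t] where [t `^ a = eta * t]: above it the
linear term dominates, and below it monotonicity bounds [s `^ a] by [t `^ a]. *)
Lemma powR_young {R : realType} {a eta s : R} :
  0 < a < 1 -> 0 < eta -> 0 < s ->
  s `^ a <= eta * s + eta `^ (- a / (1 - a)).
Proof.
move=> /andP[a0 a1] eta0 s0.
have a1' : 1 - a != 0 by rewrite gt_eqF// subr_gt0.
pose t := eta `^ (- (1 - a)^-1).
have t0 : 0 < t by exact: powR_gt0.
have ta : t `^ (a - 1) = eta.
  by rewrite -powRrM -[a - 1]opprB mulrNN mulVf// powRr1// ltW.
have tb : t `^ a = eta `^ (- a / (1 - a)).
  by rewrite -powRrM; congr (_ `^ _); field.
have [st|ts] := leP s t.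
  rewrite -tb; apply: (@le_trans _ _ (t `^ a)).
    by apply: (ge0_ler_powR (ltW a0)) => //; rewrite nnegrE ltW.
  by rewrite lerDr mulr_ge0// ltW.
rewrite -(mulr_powRB1 (ltW s0) a0) mulrC.
apply: le_trans (_ : eta * s <= _); last by rewrite lerDl powR_ge0.
rewrite ler_wpM2r// ?(ltW s0)// -ta -[a - 1]opprB !powRN.
rewrite lef_pV2 ?posrE ?powR_gt0//.
by apply: ge0_ler_powR; rewrite ?nnegrE ?subr_ge0 ltW.
Qed.

Lemma bracket_sqr {R : realType} (v : vec3 R) : bracket v ^+ 2 = 1 + enorm v ^+ 2.
Proof. by rewrite /bracket sqr_sqrtr// addr_ge0 ?sqr_ge0. Qed.

Lemma bracket_ge0 {R : realType} (v : vec3 R) : 0 <= bracket v.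
Proof. exact: sqrtr_ge0. Qed.

Lemma bracket_powR {R : realType} (v : vec3 R) (p : R) :
  bracket v `^ p = (1 + enorm v ^+ 2) `^ (p / 2).
Proof.
rewrite -bracket_sqr -(powR_mulrn 2 (bracket_ge0 v)) -powRrM.
by congr (_ `^ _); field.
Qed.

Lemma enorm_powR {R : realType} (v : vec3 R) (p : R) :
  enorm v `^ p = (enorm v ^+ 2) `^ (p / 2).
Proof.
rewrite -(powR_mulrn 2 (sqrtr_ge0 _)) -powRrM.
by congr (_ `^ _); field.
Qed.

Lemma peetre {R : realType} (v w : vec3 R) :
  1 + enorm v ^+ 2 <= 2 * bracket w ^+ 2 * (1 + enorm (v - w) ^+ 2).
Proof.
rewrite bracket_sqr.
have tri : enorm v ^+ 2 <= 2 * enorm w ^+ 2 + 2 * enorm (v - w) ^+ 2.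
  rewrite -subr_ge0 !enorm_sqr; set d := _ - _.
  have -> : d = (v.1.1 - 2 * w.1.1) ^+ 2 + (v.1.2 - 2 * w.1.2) ^+ 2
      + (v.2 - 2 * w.2) ^+ 2 by rewrite /d /=; ring.
  by rewrite !addr_ge0 ?sqr_ge0.
by have := sqr_ge0 (enorm w); have := sqr_ge0 (enorm (v - w)); nra.
Qed.

(** With [a = - gamma / 2] and [r = |v - w|^2], the left-hand side is
[(<v>^2 / r) `^ a]; Peetre's inequality bounds it by
[(2 <w>^2 (1 + r^-1)) `^ a], the first factor loses its exponent because it is at
least 1, and the second one is split by Young's inequality. *)
Lemma weighted_kernel_le {R : realType} (gamma eta : R) (v w : vec3 R) :
  -2 < gamma < 0 -> 0 < eta <= 1 ->
  bracket v `^ (- gamma) * enorm (v - w) `^ gamma <=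
  2 * bracket w ^+ 2 * (eta + eta `^ (gamma / (2 + gamma))
                        + eta / enorm (v - w) ^+ 2).
Proof.
move=> /andP[g2 g0] /andP[eta0 eta1].
set W := 2 * bracket w ^+ 2.
have W1 : 1 <= W.
  by rewrite /W bracket_sqr; have := sqr_ge0 (enorm w); lra.
have W0 : 0 <= W by exact: le_trans W1.
(* At [v = w] the singular factor is [0 `^ gamma = 0]. *)
have [r0|r0] := eqVneq (enorm (v - w)) 0.
  rewrite r0 powR0 ?lt_eqF// mulr0 mulr_ge0// addr_ge0//.
    by rewrite addr_ge0 ?powR_ge0// ltW.
  by rewrite divr_ge0 ?sqr_ge0// ltW.
pose a := - gamma / 2.
have a01 : 0 < a < 1 by rewrite /a; apply/andP; split; lra.
have rr : 0 < enorm (v - w) ^+ 2 by rewrite lt_def sqrf_eq0 r0 sqr_ge0.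
rewrite bracket_powR enorm_powR -/a.
have -> : gamma / 2 = - a by rewrite /a; field.
have pE : gamma / (2 + gamma) = - a / (1 - a).
  by rewrite /a; field; rewrite gt_eqF//; lra.
rewrite pE; set r := enorm (v - w) ^+ 2 in rr *.
pose s := 1 + r^-1.
have ri : 0 < r^-1 by rewrite invr_gt0.
have s0 : 0 < s by rewrite /s; lra.
apply: le_trans (_ : W * s `^ a <= _); last first.
  rewrite ler_wpM2l//; apply: le_trans (powR_young a01 eta0 s0) _.
  by rewrite /s mulrDr mulr1 addrAC.
have [a0 a1] := andP a01.
rewrite -[- a]mulN1r (powRrM r) powR_inv1 ?(ltW rr)//.
rewrite -powRM ?addr_ge0 ?sqr_ge0 ?(ltW ri)//.
apply: (@le_trans _ _ ((W * s) `^ a)).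
  apply: ge0_ler_powR; first exact: ltW.
  - by rewrite nnegrE mulr_ge0 ?(ltW ri)// addr_ge0 ?sqr_ge0.
  - by rewrite nnegrE mulr_ge0 ?(ltW s0).
  - have -> : W * s = W * (1 + r) / r by rewrite /s; field; rewrite gt_eqF.
    by rewrite ler_wpM2r ?(ltW ri)//; exact: peetre.
rewrite powRM ?(ltW s0)// ler_wpM2r ?powR_ge0//.
by rewrite ler1_powR// ltW.
Qed.

(** * Regularity and support of the weighted test function *)

Lemma is_derive_weight {R : realType} (i : 'I_3) (p : R) (v : vec3 R) :
  is_derive v (unit3 R i) (fun u => bracket u `^ p)
    (p * coord3 i v / (1 + enorm v ^+ 2) * bracket v `^ p).
Proof.
rewrite -[v in is_derive v]addr0 -(scale0r (unit3 R i)); apply/is_derive_lineP.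
have q0 (u : vec3 R) : 0 < 1 + enorm u ^+ 2 by rewrite ltr_pwDl ?sqr_ge0.
pose q (t : R) := 1 + (enorm v ^+ 2 + 2 * coord3 i v * t + t ^+ 2).
have -> : (fun t : R => bracket (v + t *: unit3 R i) `^ p) =
    expR \o (fun t => p / 2 * ln (q t)).
  apply/funext => t /=; rewrite bracket_powR enorm_sqr_line.
  by rewrite /powR gt_eqF// -enorm_sqr_line.
have q00 : q 0 = 1 + enorm v ^+ 2 by rewrite /q; ring.
have dq : is_derive (0 : R) (1 : R) q (2 * coord3 i v).
  rewrite /q; apply: is_derive_eq.
  by rewrite /GRing.scale /=; ring.
have dln : is_derive (q 0) (1 : R) (@ln R) (q 0)^-1.
  by apply: is_derive1_ln; rewrite q00.
have dlq := is_derive1_comp dln dq.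
have de := is_derive_expR (p / 2 * ln (q 0)).
have dpq : is_derive (0 : R) (1 : R) (fun t => p / 2 * ln (q t))
    (p / 2 * ((q 0)^-1 * (2 * coord3 i v))).
  have H := is_deriveM (is_derive_cst (p / 2) (0 : R) (1 : R)) dlq.
  by apply: (is_derive_eq H); rewrite scaler0 addr0.
have H := @is_derive1_comp _ expR (fun t => p / 2 * ln (q t)) _ _ _ de dpq.
apply: (is_derive_eq H); rewrite q00 bracket_powR /powR gt_eqF//.
by field; rewrite gt_eqF.
Qed.

Lemma continuous_weight {R : realType} (p : R) :
  continuous (fun u : vec3 R => bracket u `^ p).
Proof.
have -> : (fun u : vec3 R => bracket u `^ p) =
    expR \o (fun u => p / 2 * ln (1 + enorm (u - 0) ^+ 2)).
  apply/funext => u /=; rewrite subr0 bracket_powR /powR gt_eqF//.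
  by rewrite ltr_pwDl ?sqr_ge0.
move=> u; apply: continuous_comp; last exact: continuous_expR.
apply: cvgM; first exact: cvg_cst.
apply: (@continuous_comp _ _ _ (fun u : vec3 R => 1 + enorm (u - 0) ^+ 2) (@ln R)).
  by apply: cvgD; [exact: cvg_cst|exact: continuous_enorm_sqr].
by apply: continuous_ln; rewrite ltr_pwDl ?sqr_ge0.
Qed.

Lemma Cn3_weighted {R : realType} (p : R) (phi : vec3 R -> R) :
  Cn3 1 phi -> Cn3 1 (fun u => bracket u `^ p * phi u).
Proof.
move=> [cphi dphi]; split.
  by move=> v; apply: cvgM; [exact: continuous_weight|exact: cphi].
move=> i; have [dphi_i cdphi_i] := dphi i.
have D v : is_derive v (unit3 R i) (fun u => bracket u `^ p * phi u)
    (bracket v `^ p * partial3 i phi v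
     + phi v * (p * coord3 i v / (1 + enorm v ^+ 2) * bracket v `^ p)).
  have dp : is_derive v (unit3 R i) phi (partial3 i phi v) by exact: DeriveDef.
  exact: is_deriveM (is_derive_weight i p v) dp.
split; first by move=> v; have [] := D v.
have -> : partial3 i (fun u => bracket u `^ p * phi u) = fun v =>
    bracket v `^ p * partial3 i phi v
    + phi v * (p * coord3 i v / (1 + enorm (v - 0) ^+ 2) * bracket v `^ p).
  by apply/funext => v; rewrite subr0; have [_ <-] := D v.
move=> v; apply: cvgD; apply: cvgM.
- exact: continuous_weight.
- exact: cdphi_i.
- exact: cphi.
apply: cvgM; last exact: continuous_weight.
apply: cvgM; first by apply: cvgM; [exact: cvg_cst|exact: continuous_coord3].
apply: cvgV; first by rewrite gt_eqF// ltr_pwDl ?sqr_ge0.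
by apply: cvgD; [exact: cvg_cst|exact: continuous_enorm_sqr].
Qed.

Lemma compact_support_bounded {R : realType} (phi : vec3 R -> R) :
  compactly_supported phi ->
  exists A : R, forall v j, A < `|coord3 j v| -> phi v = 0.
Proof.
move=> /compact_bounded[A [_ HA]]; exists (A + 1) => v j Av.
apply/eqP; apply: contraTT Av => phiv; rewrite -leNgt.
apply: (@le_trans _ _ `|v|).
  rewrite prod_normE /coord3; case: ifP => _; last case: ifP => _.
  - by rewrite !le_max lexx.
  - by rewrite !le_max lexx orbT.
  - by rewrite le_max lexx orbT.
by apply: (HA (A + 1)); [rewrite ltrDl|exact: subset_closure].
Qed.

(** * The quadratic form of the potential *)

Lemma powR_half_sqr {R : realType} (x p : R) : (x `^ (p / 2)) ^+ 2 = x `^ p.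
Proof.
rewrite -(powR_mulrn 2 (powR_ge0 _ _)) -powRrM.
by congr (_ `^ _); field.
Qed.

(** The case of a unit point mass at [w]: the kernel estimate is integrated against
[psi^2 = phi^2 <v>^gamma], and Hardy's inequality for [psi] controls the singular
term. *)
Lemma potential_section_le {R : realType} (gamma eta : R) (phi : vec3 R -> R)
    (w : vec3 R) :
  -2 < gamma < 0 -> 0 < eta <= 1 -> Cn3 1 phi -> compactly_supported phi ->
  (\int[@lebesgue3 R]_v (phi v ^+ 2 * bracket v `^ gamma)%:E < +oo)%E ->
  (\int[@lebesgue3 R]_v (phi v ^+ 2 * enorm (v - w)%R `^ gamma)%:E <=
   (2 * bracket w ^+ 2)%:E *
     ((eta + eta `^ (gamma / (2 + gamma)))%:E *
        \int[@lebesgue3 R]_v (phi v ^+ 2 * bracket v `^ gamma)%:E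
      + (4 * eta)%:E *
        \int[@lebesgue3 R]_v
          (enorm (grad3 (fun u => bracket u `^ (gamma / 2) * phi u)%R v)
             ^+ 2)%:E))%E.
Proof.
move=> hg heta phi1 /compact_support_bounded[A supp] fin.
have [eta0 eta1] := andP heta.
set psi := fun u => bracket u `^ (gamma / 2) * phi u.
have psi1 : Cn3 1 psi by exact: Cn3_weighted.
have psupp v j : A < `|coord3 j v| -> psi v = 0.
  by move=> /supp; rewrite /psi => ->; rewrite mulr0.
have psiE v : phi v ^+ 2 * bracket v `^ gamma = psi v ^+ 2.
  by rewrite /psi exprMn powR_half_sqr mulrC.
have EpsiE : (fun v => (phi v ^+ 2 * bracket v `^ gamma)%:E) =
    fun v => (psi v ^+ 2)%:E.
  by apply/funext => v; rewrite psiE.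
rewrite EpsiE in fin *.
have H := hardy psi A w psi1 psupp fin.
pose K := eta + eta `^ (gamma / (2 + gamma)).
have K0 : 0 <= K by rewrite addr_ge0 ?powR_ge0 ?ltW.
have W0 : 0 <= 2 * bracket w ^+ 2 by rewrite mulr_ge0 ?sqr_ge0.
have mpsi2 : measurable_fun [set: vec3 (measurableTypeR R)] (fun v => psi v ^+ 2).
  by apply: continuous_measurable3 => v; apply: cvgM; exact: psi1.1.
have mdiv : measurable_fun [set: vec3 (measurableTypeR R)]
    (fun v => psi v ^+ 2 / enorm (v - w)%R ^+ 2).
  by apply: measurable_funM => //; exact: measurable_inv_enorm_sqr.
apply: (@le_trans _ _ ((2 * bracket w ^+ 2)%:E * (K%:E *
    \int[@lebesgue3 R]_v (psi v ^+ 2)%:E + eta%:E *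
    \int[@lebesgue3 R]_v (psi v ^+ 2 / enorm (v - w)%R ^+ 2)%:E))%E); last first.
  apply: lee_wpmul2l; first by rewrite lee_fin.
  apply: leeD => //; rewrite mulrC EFinM -muleA; apply: lee_wpmul2l => //.
  by rewrite lee_fin ltW.
have mE2 : measurable_fun [set: vec3 (measurableTypeR R)] (fun v => (psi v ^+ 2)%:E).
  exact/measurable_EFinP.
have mEd : measurable_fun [set: vec3 (measurableTypeR R)]
    (fun v => (psi v ^+ 2 / enorm (v - w)%R ^+ 2)%:E).
  exact/measurable_EFinP.
have p0 v : (0 <= (psi v ^+ 2)%:E)%E by rewrite lee_fin sqr_ge0.
have d0 v : (0 <= (psi v ^+ 2 / enorm (v - w)%R ^+ 2)%:E)%E.
  by rewrite lee_fin divr_ge0 ?sqr_ge0.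
rewrite -!ge0_integralZl_EFin//; last exact: ltW.
rewrite -ge0_integralD//; last 4 first.
- by move=> v _; apply: mule_ge0 => //; rewrite lee_fin.
- exact: measurable_funeM.
- by move=> v _; apply: mule_ge0 => //; rewrite lee_fin ltW.
- exact: measurable_funeM.
rewrite -ge0_integralZl_EFin//; last 2 first.
- by move=> v _; apply: adde_ge0; apply: mule_ge0 => //; rewrite lee_fin ltW.
- by apply: emeasurable_funD; exact: measurable_funeM.
apply: ge0_le_integral => //.
- by move=> v _; rewrite lee_fin mulr_ge0 ?sqr_ge0 ?powR_ge0.
- apply/measurable_EFinP; apply: measurable_funM.
    by apply: continuous_measurable3 => v; apply: cvgM; exact: phi1.1.
  rewrite (_ : (fun v => _) =
      (@powR R ^~ (gamma / 2)) \o (fun v => enorm (v - w) ^+ 2)).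
    apply: measurableT_comp; first exact: measurable_powR.
    by apply: continuous_measurable3; exact: continuous_enorm_sqr.
  by apply/funext => v; rewrite enorm_powR.
- by apply: measurable_funeM; apply: emeasurable_funD; exact: measurable_funeM.
move=> v _; rewrite -(EFinM K) -(EFinM eta) -EFinD -EFinM lee_fin.
have -> : phi v ^+ 2 * enorm (v - w) `^ gamma =
    psi v ^+ 2 * (bracket v `^ (- gamma) * enorm (v - w) `^ gamma).
  rewrite mulrA -psiE powRN mulfK// gt_eqF// powR_gt0//.
  by rewrite /bracket sqrtr_gt0 ltr_pwDl ?sqr_ge0.
rewrite [leRHS](_ : _ = psi v ^+ 2 * (2 * bracket w ^+ 2 *
   (K + eta / enorm (v - w) ^+ 2))); last by ring.
by rewrite ler_wpM2l ?sqr_ge0//; exact: weighted_kernel_le.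
Qed.

Lemma measurable_coord3 {R : realType} (i : 'I_3) :
  measurable_fun [set: vec3 (measurableTypeR R)] (@coord3 R i).
Proof. by apply: continuous_measurable3; exact: continuous_coord3. Qed.

Lemma measurable_kernel {R : realType} (gamma : R) :
  measurable_fun [set: vec3 (measurableTypeR R) * vec3 (measurableTypeR R)]
    (fun p => enorm ((p.1 : vec3 R) - p.2)%R `^ gamma).
Proof.
rewrite (_ : (fun p => _) = (@powR R ^~ (gamma / 2)) \o
    (fun p => \sum_i (coord3 i p.1 - coord3 i p.2) ^+ 2)); last first.
  apply/funext => p; rewrite /= enorm_powR enorm_sqr_sum.
  by congr (_ `^ _); apply: eq_bigr => i _; rewrite coord3B.
apply: measurableT_comp; first exact: measurable_powR.
apply: measurable_sum => i; apply: measurable_funX; apply: measurable_funB.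
- exact: measurableT_comp (measurable_coord3 i) measurable_fst.
- exact: measurableT_comp (measurable_coord3 i) measurable_snd.
Qed.

(** Tonelli's theorem reduces the double integral to a superposition of point
masses; the factor [<w>^2] of each of them is what turns the bound into a second
moment of [g]. *)
Lemma potential_form_le {R : realType} (gamma eta : R) (phi g : vec3 R -> R) :
  -2 < gamma < 0 -> 0 < eta <= 1 -> Cn3 1 phi -> compactly_supported phi ->
  measurable_fun [set: vec3 (measurableTypeR R)] g -> (forall w, 0 <= g w) ->
  (\int[@lebesgue3 R]_v (phi v ^+ 2 * bracket v `^ gamma)%:E < +oo)%E ->
  (\int[@lebesgue3 R]_v ((phi v ^+ 2)%:E *
     \int[@lebesgue3 R]_w (enorm (v - w)%R `^ gamma * g w)%:E) <=
   (\int[@lebesgue3 R]_w (g w * bracket w ^+ 2)%:E) *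
     (2%:E * ((eta + eta `^ (gamma / (2 + gamma)))%:E *
        \int[@lebesgue3 R]_v (phi v ^+ 2 * bracket v `^ gamma)%:E
      + (4 * eta)%:E *
        \int[@lebesgue3 R]_v
          (enorm (grad3 (fun u => bracket u `^ (gamma / 2) * phi u)%R v)
             ^+ 2)%:E)))%E.
Proof.
move=> hg heta phi1 suppphi mg g0 fin.
have [eta0 eta1] := andP heta.
set X := ((_ + _)%:E * _ + _)%E.
have X0 : (0 <= X)%E.
  apply: adde_ge0; apply: mule_ge0; rewrite ?lee_fin.
  - by rewrite addr_ge0 ?powR_ge0 ?ltW.
  - apply: integral_ge0 => v _; rewrite lee_fin.
    by rewrite mulr_ge0 ?sqr_ge0 ?powR_ge0.
  - by rewrite mulr_ge0 ?ltW.
  - by apply: integral_ge0 => v _; rewrite lee_fin sqr_ge0.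
have mphi2 : measurable_fun [set: vec3 (measurableTypeR R)] (fun v => phi v ^+ 2).
  by apply: continuous_measurable3 => v; apply: cvgM; exact: phi1.1.
pose F (p : vec3 (measurableTypeR R) * vec3 (measurableTypeR R)) :=
  (phi p.1 ^+ 2 * enorm ((p.1 : vec3 R) - p.2)%R `^ gamma * g p.2)%:E.
have F0 p : (0 <= F p)%E.
  rewrite lee_fin; apply: mulr_ge0; last exact: g0.
  by apply: mulr_ge0; [exact: sqr_ge0|exact: powR_ge0].
have mF : measurable_fun setT F.
  apply/measurable_EFinP; apply: measurable_funM; first apply: measurable_funM.
  - exact: measurableT_comp mphi2 measurable_fst.
  - exact: measurable_kernel.
  - exact: measurableT_comp mg measurable_snd.
have mE (w : vec3 R) : measurable_fun [set: vec3 (measurableTypeR R)]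
    (fun v => enorm (v - w)%R `^ gamma).
  exact: (measurable_fun_pair1 w (measurable_kernel gamma)).
have mE' (v : vec3 R) : measurable_fun [set: vec3 (measurableTypeR R)]
    (fun w => enorm (v - w)%R `^ gamma).
  exact: (measurable_fun_pair2 v (measurable_kernel gamma)).
have -> : (fun v => (phi v ^+ 2)%:E *
     \int[@lebesgue3 R]_w (enorm (v - w)%R `^ gamma * g w)%:E)%E =
    fun v => (\int[@lebesgue3 R]_w F (v, w))%E.
  apply/funext => v; rewrite -ge0_integralZl_EFin ?sqr_ge0//.
  - by apply: eq_integral => w _; rewrite -EFinM mulrA.
  - by move=> w _; rewrite lee_fin mulr_ge0 ?powR_ge0.
  - by apply/measurable_EFinP; apply: measurable_funM.
rewrite (fubini_tonelli F mF F0).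
have mgb : measurable_fun [set: vec3 (measurableTypeR R)]
    (fun w => (g w * bracket w ^+ 2)%:E).
  apply/measurable_EFinP; apply: measurable_funM => //.
  apply: continuous_measurable3.
  rewrite (_ : (fun w => _) = fun w : vec3 R => 1 + enorm (w - 0) ^+ 2); last first.
    by apply/funext => w; rewrite subr0 bracket_sqr.
  by move=> w; apply: cvgD; [exact: cvg_cst|exact: continuous_enorm_sqr].
rewrite -ge0_integralZr//; last 2 first.
- by move=> w _; rewrite lee_fin mulr_ge0 ?sqr_ge0.
- exact: mule_ge0.
apply: ge0_le_integral => //.
- by move=> w _; exact: integral_ge0.
- exact: measurable_fun_fubini_tonelli_G.
- exact: emeasurable_funM.
move=> w _.
have -> : (\int[@lebesgue3 R]_v F (v, w) = (g w)%:E *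
    \int[@lebesgue3 R]_v (phi v ^+ 2 * enorm (v - w)%R `^ gamma)%:E)%E.
  rewrite -ge0_integralZl_EFin//.
  - by apply: eq_integral => v _; rewrite /F /= -EFinM mulrC.
  - by move=> v _; rewrite lee_fin mulr_ge0 ?sqr_ge0 ?powR_ge0.
  - by apply/measurable_EFinP; apply: measurable_funM.
rewrite EFinM -muleA; apply: lee_wpmul2l; first by rewrite lee_fin.
rewrite muleA [((_ ^+ 2)%:E * _)%E]muleC -EFinM.
exact: potential_section_le.
Qed.

Lemma second_moment {R : realType} (g : vec3 R -> R) :
  measurable_fun [set: vec3 (measurableTypeR R)] g -> (forall v, 0 <= g v) ->
  (\int[@lebesgue3 R]_v (g v * bracket v ^+ 2)%:E = mass g + energy g)%E.
Proof.
move=> mg g0.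
rewrite /mass /energy -ge0_integralD//.
- by apply: eq_integral => v _; rewrite -EFinD bracket_sqr mulrDr mulr1.
- by move=> v _; rewrite lee_fin.
- exact/measurable_EFinP.
- by move=> v _; rewrite lee_fin mulr_ge0 ?sqr_ge0.
- by apply/measurable_EFinP; apply: measurable_funM => //;
    exact: measurable_enorm_sqr.
Qed.

Lemma ae_lebesgue3W {R : realType} (P Q : vec3 R -> Prop) :
  (forall v, P v -> Q v) ->
  {ae @lebesgue3 R, forall v, P v} -> {ae @lebesgue3 R, forall v, Q v}.
Proof. by move=> PQ; apply: negligibleS => v; apply: contra_not; exact: PQ. Qed.

(** [kappa] is the constant that multiplies [eta] in front of the gradient term.
The power [eta `^ p] is one of the powers of the two arguments of the minimum,
hence at most their sum. *)
Lemma eta_bounds {R : realType} (gamma delta : R) : -2 < gamma -> 0 < delta ->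
  let kappa := 64 * (gamma + 3) in
  let eta := Num.min 1 (delta / kappa) in
  let p := gamma / (2 + gamma) in
  [/\ 0 < eta <= 1, kappa * eta <= delta &
      eta + eta `^ p <= (2 + kappa `^ (- p)) * (1 + delta `^ p)].
Proof.
move=> g2 d0 kappa eta p.
have k0 : 0 < kappa by rewrite /kappa; lra.
have dk0 : 0 < delta / kappa by rewrite divr_gt0.
have kp : 0 < kappa `^ (- p) by exact: powR_gt0.
have dp : 0 < delta `^ p by exact: powR_gt0.
have key : eta `^ p <= 1 + kappa `^ (- p) * delta `^ p.
  rewrite /eta minElt; case: ifPn => _.
    by rewrite powR1 lerDl mulr_ge0 ?ltW.
  rewrite powRM ?invr_ge0 ?(ltW k0) ?(ltW d0)// -powR_inv1 ?(ltW k0)//.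
  by rewrite -powRrM mulN1r mulrC lerDr.
have e1 : eta <= 1 by rewrite /eta ge_min lexx.
split.
- by rewrite e1 andbT /eta lt_min ltr01.
- by rewrite mulrC -ler_pdivlMr// /eta ge_min lexx orbT.
- by nra.
Qed.

Theorem proposition1p8 (R : realType) (gamma : R) (hgamma : -2 < gamma < 0)
    (M : R) :
  exists2 C0 : R, 0 < C0 &
  forall (eps0 : R) (fin : vec3 R -> R),
    0 < eps0 -> admissible_datum eps0 fin -> normL12 fin = M%:E ->
  forall eps : R, 0 < eps <= eps0 ->
  forall g : vec3 R -> R, Yset eps fin g ->
  forall phi : vec3 R -> R, smooth3 phi -> compactly_supported phi ->
  forall delta : R, 0 < delta ->
  (- (\int[@lebesgue3 R]_v ((phi v ^+ 2)%:E * c_coef gamma g v))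
   <= delta%:E *
        \int[@lebesgue3 R]_v
          (enorm (grad3 (fun u => bracket u `^ (gamma / 2) * phi u)%R v)
             ^+ 2)%:E
      + (C0 * (1 + delta `^ (gamma / (2 + gamma))))%:E *
        \int[@lebesgue3 R]_v (phi v ^+ 2 * bracket v `^ gamma)%:E)%E.
Proof.
have [g2 g0] := andP hgamma.
pose p := gamma / (2 + gamma).
pose kappa := 64 * (gamma + 3).
have kp : 0 < kappa `^ (- p) by apply: powR_gt0; rewrite /kappa; lra.
have g3 : 0 < gamma + 3 by lra.
(* 16 (gamma + 3) is the product of 2 (gamma + 3) from the coefficient, the second
   moment 4 and the factor 2 of the kernel estimate. *)
exists (16 * (gamma + 3) * (2 + kappa `^ (- p))).
  by rewrite mulr_gt0 ?mulr_gt0// addr_gt0.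
move=> eps0 f eps0_gt0 [_ _ _ _ [massf _ energyf]] _ eps _ g.
move=> [[mg _] ae_g [massg _] energyg _] phi sphi suppphi delta delta0.
set D := (\int[@lebesgue3 R]_v (enorm (grad3 _ v) ^+ 2)%:E)%E.
set N := (\int[@lebesgue3 R]_v (phi v ^+ 2 * bracket v `^ gamma)%:E)%E.
have D0 : (0 <= D)%E by apply: integral_ge0 => v _; rewrite lee_fin sqr_ge0.
have N0 : (0 <= N)%E.
  by apply: integral_ge0 => v _; rewrite lee_fin mulr_ge0 ?sqr_ge0 ?powR_ge0.
have C0 : 0 < 16 * (gamma + 3) * (2 + kappa `^ (- p)) * (1 + delta `^ p).
  apply: mulr_gt0; last by rewrite addr_gt0 ?powR_gt0.
  by apply: mulr_gt0; [rewrite mulr_gt0|rewrite addr_gt0].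
(* If the weighted norm is infinite then so is the right-hand side. *)
have [Noo|Noo] := eqVneq N +oo%E.
  have dD0 : (0 <= delta%:E * D)%E by rewrite mule_ge0// lee_fin ltW.
  rewrite Noo gt0_muley ?lte_fin// addey ?leey//.
  by rewrite gt_eqF// (lt_le_trans _ dD0)// ltNyr.
have Nfin : (N < +oo)%E by rewrite ltey.
(* A version of [g] that is nonnegative everywhere, as Tonelli's theorem asks. *)
pose h v := Num.max (g v) 0.
have h0 v : 0 <= h v by rewrite /h le_max lexx orbT.
have mh : measurable_fun [set: vec3 (measurableTypeR R)] h.
  by apply: measurable_maxr.
have ae_h : {ae @lebesgue3 R, forall v, g v = h v}.
  by apply: ae_lebesgue3W ae_g => v /andP[gv _]; rewrite /h max_l.
have moment : (\int[@lebesgue3 R]_v (h v * bracket v ^+ 2)%:E = 4%:E)%E.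
  rewrite second_moment//.
  have -> : mass h = 1%E.
    rewrite -massf -massg; apply: ae_eq_integral => //.
    - exact/measurable_EFinP.
    - exact/measurable_EFinP.
    - by apply: ae_lebesgue3W ae_h => v /= ->.
  have -> : energy h = 3%:E.
    rewrite -energyf -energyg; apply: ae_eq_integral => //.
    - by apply/measurable_EFinP; apply: measurable_funM => //;
        exact: measurable_enorm_sqr.
    - by apply/measurable_EFinP; apply: measurable_funM => //;
        exact: measurable_enorm_sqr.
    - by apply: ae_lebesgue3W ae_h => v /= ->.
  by rewrite -EFinD; congr EFin; ring.
have mker (u : vec3 R -> R) v : measurable_fun [set: vec3 (measurableTypeR R)] u ->
    measurable_fun [set: vec3 (measurableTypeR R)]
      (fun w => (enorm (v - w)%R `^ gamma * u w)%:E).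
  move=> mu; apply/measurable_EFinP; apply: measurable_funM => //.
  exact: (measurable_fun_pair2 v (measurable_kernel gamma)).
have cE v : c_coef gamma g v = (- (2 * (gamma + 3))%:E *
    \int[@lebesgue3 R]_w (enorm (v - w)%R `^ gamma * h w)%:E)%E.
  rewrite /c_coef mulNr EFinN; congr (_ * _)%E.
  apply: ae_eq_integral => //.
  - exact: mker.
  - exact: mker.
  - by apply: ae_lebesgue3W ae_h => w /= ->.
pose P v := (\int[@lebesgue3 R]_w (enorm (v - w)%R `^ gamma * h w)%:E)%E.
have P0 v : (0 <= P v)%E.
  by apply: integral_ge0 => w _; rewrite lee_fin mulr_ge0 ?powR_ge0.
have -> : (- (\int[@lebesgue3 R]_v ((phi v ^+ 2)%:E * c_coef gamma g v)) =
    (2 * (gamma + 3))%:E * \int[@lebesgue3 R]_v ((phi v ^+ 2)%:E * P v))%E.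
  under eq_integral do rewrite cE mulNe muleN muleCA.
  rewrite integral_ge0N; last first.
    move=> v _; apply: mule_ge0; first by rewrite lee_fin mulr_ge0// ltW.
    by apply: mule_ge0; [rewrite lee_fin sqr_ge0|exact: P0].
  rewrite oppeK ge0_integralZl_EFin//.
  - by move=> v _; apply: mule_ge0; [rewrite lee_fin sqr_ge0|exact: P0].
  - apply: emeasurable_funM.
      apply/measurable_EFinP; apply: continuous_measurable3 => v.
      by apply: cvgM; exact: (sphi 0%N).
    apply: (measurable_fun_fubini_tonelli_F (m2 := @lebesgue3 R)
      (fun q => (enorm ((q.1 : vec3 R) - q.2)%R `^ gamma * h q.2)%:E)).
    + apply/measurable_EFinP; apply: measurable_funM; first exact: measurable_kernel.
      exact: measurableT_comp mh measurable_snd.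
    + by move=> q; rewrite lee_fin mulr_ge0 ?powR_ge0.
  - by rewrite mulr_ge0// ltW.
have [heta ked eb] := eta_bounds gamma delta g2 delta0.
set eta := Num.min _ _ in heta ked eb.
have := potential_form_le gamma eta phi h hgamma heta (sphi 1%N) suppphi mh h0
  Nfin.
rewrite moment -/N -/D -/p => H.
apply: (@le_trans _ _ ((2 * (gamma + 3))%:E * (4%:E * (2%:E *
   ((eta + eta `^ p)%:E * N + (4 * eta)%:E * D))))%E).
  by apply: lee_wpmul2l => //; rewrite lee_fin mulr_ge0// ltW.
rewrite [(4%:E * _)%E]muleA -(EFinM 4) muleA -EFinM.
rewrite ge0_muleDr; last 2 first.
- by rewrite mule_ge0// lee_fin addr_ge0 ?powR_ge0//; case/andP: heta => /ltW.
- by rewrite mule_ge0// lee_fin mulr_ge0//; case/andP: heta => /ltW.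
rewrite addeC; apply: leeD; rewrite muleA -EFinM; apply: lee_wpmul2r => //;
  rewrite lee_fin.
  by apply: le_trans ked; rewrite le_eqVlt; apply/orP; left; apply/eqP; ring.
have -> : 2 * (gamma + 3) * (4 * 2) = 16 * (gamma + 3) by ring.
by rewrite -[leRHS]mulrA ler_wpM2l// mulr_ge0// ltW.
Qed.
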